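(* Let $d \ge 1$, $n_1,\ldots,n_d \ge 1$ and $s \ge 0$ be integers, and let $V_s = \mathrm{range}(\Pi_{\le s})$ be the order-$s$ ANOVA subspace of $\mathbb{R}^{n_1 \times \cdots \times n_d}$. Let $$ \mathcal{I}_{d,s} = \big\{ \mathbf{i} = (i_1,\ldots,i_d) \in [1:n_1] \times \cdots \times [1:n_d] : \ |\{ j \in [1:d] : i_j \neq 1 \}| \le s \big\}. $$ Then, for any multi-index set $\mathcal{O} \subseteq [1:n_1] \times \cdots \times [1:n_d]$ containing $\mathcal{I}_{d,s}$, the observation map $$ \Lambda : X \in \mathbb{R}^{n_1 \times \cdots \times n_d} \mapsto \big( X[\mathbf{i}], \ \mathbf{i} \in \mathcal{O} \big) \in \mathbb{R}^{|\mathcal{O}|} $$ satisfies $$ V_s \cap \ker(\Lambda) = \{0\}. $$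
   Context: Notation: $[1:n] = \{1,\ldots,n\}$. ANOVA projectors on $\mathbb{R}^{n_1 \times \cdots \times n_d}$: for $\ell \in [1:d]$, the operator $P_{-\ell}$ averages out the $\ell$-th variable, i.e. $$ (P_{-\ell} X)[i_1,\ldots,i_d] = \frac{1}{n_\ell} \sum_{k=1}^{n_\ell} X[i_1,\ldots,i_{\ell-1},k,i_{\ell+1},\ldots,i_d]. $$ These operators commute with one another, and for $S \subseteq [1:d]$, $$ \Pi_S := \prod_{j \in S} (\mathrm{Id} - P_{-j}) \prod_{\ell \in [1:d] \setminus S} P_{-\ell}, \qquad \Pi_{\le s} := \sum_{S \subseteq [1:d],\ |S| \le s} \Pi_S . $$ The $\Pi_S$ are mutually orthogonal projectors, and $V_s := \mathrm{range}(\Pi_{\le s})$ is the orthogonal direct sum of the spaces $\mathrm{range}(\Pi_S)$ over $|S| \le s$. *)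

(* Defs.v *)
From HB Require Import structures.
From mathcomp Require Import all_boot all_order all_algebra.
From mathcomp Require Export reals.

Set Implicit Arguments.
Unset Strict Implicit.
Unset Printing Implicit Defensive.

Import Order.TTheory GRing.Theory Num.Theory.
Local Open Scope ring_scope.

(* Axes and coordinates are numbered from 0, so the coordinate value written  *)
(* 1 in one-based notation is the ordinal of value 0.                         *)
Definition multi_index (d : nat) (n : 'I_d -> nat) : finType :=
  {dffun forall j : 'I_d, 'I_(n j)}.

Definition tensor (R : realType) (d : nat) (n : 'I_d -> nat) : vectType R :=
  {ffun multi_index n -> R^o}.

Section Anova.
Variables (R : realType) (d : nat) (n : 'I_d -> nat).

Definition set_coord (i : multi_index n) (l : 'I_d) (k : 'I_(n l)) :
  multi_index n := finfun (dfwith i k).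

Definition avg_fun (l : 'I_d) (X : tensor R n) : tensor R n :=
  [ffun i : multi_index n =>
     (n l)%:R^-1 * \sum_(k < n l) X (set_coord i k)].

Fact avg_fun_is_linear (l : 'I_d) : linear (avg_fun l).
Proof.
move=> a X Y; apply/ffunP => i; rewrite !ffunE.
under eq_bigr => k _ do rewrite !ffunE.
by rewrite big_split /= -scaler_sumr mulrDr /GRing.scale /= mulrCA.
Qed.

HB.instance Definition _ (l : 'I_d) :=
  GRing.isLinear.Build R (tensor R n) (tensor R n) _ (avg_fun l)
    (avg_fun_is_linear l).

Definition avg (l : 'I_d) : 'End(tensor R n) := linfun (avg_fun l).

Lemma avgE (l : 'I_d) (X : tensor R n) (i : multi_index n) :
  avg l X i = (n l)%:R^-1 * \sum_(k < n l) X (set_coord i k).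
Proof. by rewrite lfunE /= ffunE. Qed.

Lemma avg_comm (l m : 'I_d) : (avg l \o avg m = avg m \o avg l)%VF.
Proof.
have [<-//|lm] := eqVneq l m.
apply/lfunP => X; apply/ffunP => i; rewrite !comp_lfunE !avgE.
under eq_bigr => k _ do rewrite avgE.
under [in RHS]eq_bigr => k _ do rewrite avgE.
rewrite -!mulr_sumr exchange_big mulrCA /=; do 2!congr (_ * _).
apply: eq_bigr => k _; apply: eq_bigr => k' _; congr (X _).
apply/ffunP => j; rewrite !ffunE.
have [->|jl] := eqVneq j l.
  by rewrite dfwith_out 1?eq_sym // ffunE !dfwith_in.
have [->|jm] := eqVneq j m.
  by rewrite dfwith_in dfwith_out // ffunE dfwith_in.
by rewrite !dfwith_out 1?eq_sym // !ffunE !dfwith_out 1?eq_sym.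
Qed.

(* The factors commute (avg_comm), so the order of composition is immaterial  *)
Definition anova_proj (S : {set 'I_d}) : 'End(tensor R n) :=
  ((\big[@comp_lfun R _ _ _ / \1]_(j in S) (\1 - avg j))
     \o (\big[@comp_lfun R _ _ _ / \1]_(l in ~: S) avg l))%VF.

Definition anova_proj_le (s : nat) : 'End(tensor R n) :=
  \sum_(S : {set 'I_d} | (#|S| <= s)%N) anova_proj S.

Definition anova_space (s : nat) : {vspace tensor R n} :=
  limg (anova_proj_le s).

Definition anchored_indices (s : nat) : {set multi_index n} :=
  [set i : multi_index n | (#|[set j | nat_of_ord (i j) != 0%N]| <= s)%N].

Definition obs_fun (O : {set multi_index n}) (X : tensor R n) :
  {ffun {i : multi_index n | i \in O} -> R^o} :=
  [ffun i : {i : multi_index n | i \in O} => X (val i)].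

Fact obs_fun_is_linear (O : {set multi_index n}) : linear (obs_fun O).
Proof. by move=> a X Y; apply/ffunP => i; rewrite !ffunE. Qed.

HB.instance Definition _ (O : {set multi_index n}) :=
  GRing.isLinear.Build R (tensor R n)
    {ffun {i : multi_index n | i \in O} -> R^o} _ (obs_fun O)
    (obs_fun_is_linear O).

Definition obs (O : {set multi_index n}) :
  'Hom(tensor R n, {ffun {i : multi_index n | i \in O} -> R^o}) :=
  linfun (obs_fun O).

Lemma obsE (O : {set multi_index n}) (X : tensor R n)
    (i : {i : multi_index n | i \in O}) :
  obs O X i = X (val i).
Proof. by rewrite lfunE /= ffunE. Qed.

End Anova.

Arguments anova_space R {d} n s.
Arguments anchored_indices {d} n s.
Arguments obs R {d n} O.

(* Main.v *)
Require Import Defs.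
From mathcomp Require Import all_boot all_order all_algebra.
From mathcomp Require Import reals.

(** Each summand of an element [X] of [V_s] depends on at most [s] coordinates,
    so the alternating sum of the values of [X] at the points obtained from [i]
    by resetting to the anchor the coordinates in [U], over all subsets [U] of
    a set [T] with more than [s] elements, vanishes.  Taking for [T] the set of
    non-anchored coordinates of [i] expresses [X i] by values at points with
    fewer non-anchored coordinates; by induction [X] vanishes everywhere as
    soon as it vanishes on the anchored indices. *)

Set Implicit Arguments.
Unset Strict Implicit.
Unset Printing Implicit Defensive.

Import GRing.Theory Num.Theory.
Local Open Scope ring_scope.

Section Anova.
Variables (R : realType) (d : nat) (n : 'I_d -> nat).
Hypothesis n_gt0 : forall j, (0 < n j)%N.
Implicit Types (X Y : tensor R n) (i : multi_index n) (S T U : {set 'I_d}).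

Lemma set_coordK i (l : 'I_d) (k k' : 'I_(n l)) :
  set_coord (set_coord i k) k' = set_coord i k'.
Proof.
apply/ffunP => j; rewrite !ffunE; have [->|jl] := eqVneq j l.
  by rewrite !dfwith_in.
by rewrite !dfwith_out 1?eq_sym // ffunE dfwith_out 1?eq_sym.
Qed.

Lemma avg_set_coord l X i (k : 'I_(n l)) : avg R n l X (set_coord i k) = avg R n l X i.
Proof.
by rewrite !avgE; congr (_ * _); apply: eq_bigr => k' _; rewrite set_coordK.
Qed.

Lemma avg_idem l X : avg R n l (avg R n l X) = avg R n l X.
Proof.
apply/ffunP => i; rewrite avgE.
under eq_bigr do rewrite avg_set_coord.
rewrite sumr_const card_ord -[X in _ * X]mulr_natl mulKf //.
by rewrite pnatr_eq0 -lt0n.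
Qed.

Lemma avgC l m X : avg R n l (avg R n m X) = avg R n m (avg R n l X).
Proof. by have /lfunP/(_ X) := avg_comm R n l m; rewrite !comp_lfunE. Qed.

(** As [l] lies outside [S], the averaging along [l] is itself a factor of the projector; by
    commutation the extra copy reaches it and is absorbed by idempotence. *)
Lemma avg_anova_proj S l Y : l \notin S ->
  avg R n l (anova_proj R n S Y) = anova_proj R n S Y.
Proof.
move=> lS; rewrite /anova_proj comp_lfunE.
set Z := (\big[_/_]_(l in ~: S) _ : 'End(_)) Y.
have lZ : avg R n l Z = Z.
  (* Over an explicit list containing [l], induction moves the averaging inward until it meets its
     own factor. *)
  rewrite {}/Z -big_filter.
  have: l \in [seq m <- index_enum _ | m \in ~: S].
    by rewrite mem_filter inE lS mem_index_enum.
  elim: [seq m <- _ | _] => // m r IHr; rewrite inE big_cons comp_lfunE.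
  case/predU1P=> [<-|/IHr lr]; first exact: avg_idem.
  by rewrite avgC lr.
rewrite -big_filter; elim: [seq m <- _ | _] => [|m r IHr].
  by rewrite big_nil id_lfunE.
by rewrite big_cons comp_lfunE add_lfunE opp_lfunE id_lfunE linearB /= avgC IHr.
Qed.

Definition anchor_on U i : multi_index n :=
  [ffun j => if j \in U then Ordinal (n_gt0 j) else i j].

Definition nonanchored i : {set 'I_d} := [set j | nat_of_ord (i j) != 0%N].

Lemma anchor_on0 i : anchor_on set0 i = i.
Proof. by apply/ffunP => j; rewrite ffunE inE. Qed.

Lemma anchor_onU1 U t i :
  anchor_on (t |: U) i = set_coord (anchor_on U i) (Ordinal (n_gt0 t)).
Proof.
apply/ffunP => j; rewrite !ffunE !inE; have [->|jt] := eqVneq j t.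
  by rewrite dfwith_in.
by rewrite dfwith_out 1?eq_sym // ffunE.
Qed.

Lemma nonanchored_anchor_on U i : nonanchored (anchor_on U i) = nonanchored i :\: U.
Proof. by apply/setP => j; rewrite !inE ffunE; case: ifP. Qed.

Definition anchor_diff T X i : R :=
  \sum_(U in powerset T) (-1) ^+ #|U| * X (anchor_on U i).

(** Pair each [U] avoiding [t] with [t |: U]: the two points differ only along [t], where [X] is
    constant, and the signs are opposite. *)
Lemma anchor_diff_eq0 T t X i : t \in T -> avg R n t X = X ->
  anchor_diff T X i = 0.
Proof.
move=> tT tX; rewrite /anchor_diff (bigID (fun U => t \in U)) /=.
rewrite (reindex_onto (fun U => t |: U) (fun U => U :\ t)) /=; last first.
  by move=> U /andP[_]; exact: setD1K.
rewrite (eq_bigl (fun U => (U \in powerset T) && (t \notin U))); last first.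
  move=> U; rewrite !powersetE subUset sub1set tT setU11 andbT /=.
  congr (_ && _); apply/eqP/idP => [<-|]; first by rewrite !inE eqxx.
  exact: setU1K.
rewrite -big_split big1 //= => U /andP[_ tU].
rewrite anchor_onU1 -tX avg_set_coord cardsU1 tU exprS mulN1r mulNr.
exact: addNr.
Qed.

Lemma anchor_diff_anova_space s T X i : X \in anova_space R n s ->
  (s < #|T|)%N -> anchor_diff T X i = 0.
Proof.
case/memv_imgP => Y _ -> sT; rewrite /anova_proj_le sum_lfunE /anchor_diff.
under eq_bigr do rewrite sum_ffunE mulr_sumr.
rewrite exchange_big big1 //= => S Ss.
(* Since [S] is smaller than [T], some axis [t] of [T] is averaged out in the summand of [S]. *)
have /subsetPn[t tT tS] : ~~ (T \subset S).
  by apply: contraL (leq_ltn_trans Ss sT) => /subset_leq_card; rewrite -leqNgt.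
exact: anchor_diff_eq0 tT (avg_anova_proj Y tS).
Qed.

Lemma anova_space_eq0 s X : X \in anova_space R n s ->
  {in anchored_indices n s, forall i, X i = 0} -> X = 0.
Proof.
move=> VX X0; apply/ffunP => i; rewrite ffunE.
(* Strong induction on the number of non-anchored coordinates. *)
have [m] := ubnP #|nonanchored i|; elim: m i => // m IHm i im.
have [is_small|sT] := leqP #|nonanchored i| s; first by apply: X0; rewrite inE.
have := anchor_diff_anova_space i VX sT.
rewrite /anchor_diff (bigD1 set0) /=; last by rewrite powersetE sub0set.
(* The empty set contributes [X i]; any other [U] anchors at least one more coordinate, so its term
   vanishes by induction. *)
rewrite cards0 mul1r anchor_on0 big1 ?addr0 // => U /andP[].
rewrite powersetE => UT U0; rewrite IHm ?mulr0 // nonanchored_anchor_on.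
apply: (@leq_trans #|nonanchored i|) => //; apply: proper_card.
rewrite properEneq subsetDl andbT; apply: contra U0 => /eqP/setDidPl.
by rewrite -setI_eq0 (setIidPr UT).
Qed.

End Anova.

Theorem proposition3 (R : realType) (d : nat) (n : 'I_d -> nat) (s : nat)
    (hd : (0 < d)%N) (hn : forall j : 'I_d, (0 < n j)%N)
    (O : {set multi_index n}) (hO : anchored_indices n s \subset O) :
  (anova_space R n s :&: lker (obs R O))%VS = 0%VS.
Proof.
apply/eqP; rewrite -subv0; apply/subvP => X; rewrite memv_cap memv0 memv_ker.
case/andP => VX /eqP kX; apply/eqP/(anova_space_eq0 hn VX) => i iI.
have iO := subsetP hO i iI.
by rewrite -[i]/(val (exist (fun i => i \in O) i iO)) -obsE kX ffunE.
Qed.
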